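(* Let $n\ge 1$ be an integer, let $N\in\mathbb{Z}_+$, and let $\mathbf X=(X_1,\dots,X_n)$ be a random vector taking values in $\mathbb{Z}_+^n$. Then $\mathbf X$ is a joint mix with joint center $N$ if and only if it has a representation $$\mathbf X=\sum_{k=1}^{N}\mathbf X_k,$$ where $\mathbf X_1,\dots,\mathbf X_N$ are $n$-dimensional binary multinomial random vectors.
   Context: $\mathbb{Z}_+=\{0,1,2,\dots\}$. All random vectors are defined on the same atomless probability space $(\Omega,\mathcal{A},\mathbb{P})$, and equalities between random variables or random vectors are understood almost surely. An empty sum equals zero. A random vector $(X_1,\dots,X_n)$ is a joint mix with joint center $K\in\mathbb{R}$ if $X_1+\dots+X_n=K$. A random vector is an ($n$-dimensional) binary multinomial random vector if it takes values in $\{0,1\}^n$ and exactly one of its components is $1$ (that is, it has a multinomial distribution with number-of-trials parameter equal to $1$). No independence or identical distribution of $\mathbf X_1,\dots,\mathbf X_N$ is required. *)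

(* Defs.v *)
From HB Require Import structures.
From mathcomp Require Import all_boot all_order all_algebra.
From mathcomp Require Import all_classical all_reals all_analysis.

Set Implicit Arguments.
Unset Strict Implicit.
Unset Printing Implicit Defensive.

Import Order.TTheory GRing.Theory Num.Theory.
Import numFieldNormedType.Exports.

Local Open Scope classical_set_scope.
Local Open Scope ring_scope.

Definition atomless d (T : measurableType d) (R : realType)
    (P : probability T R) : Prop :=
  forall A : set T, measurable A -> (0 < P A)%E ->
    exists B : set T, [/\ measurable B, B `<=` A, (0 < P B)%E & (P B < P A)%E].

(* An n-dimensional random vector is the family X : 'I_n -> {RV P >-> R} of its
   components. As equalities between random vectors are understood almost
   surely, so are the constraints on the values that they take. *)

Definition Znneg_valued d (T : measurableType d) (R : realType)
    (P : probability T R) (n : nat) (X : 'I_n -> {RV P >-> R}) : Prop :=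
  {ae P, forall w, forall i : 'I_n, X i w \is a Num.nat}.

Definition joint_mix d (T : measurableType d) (R : realType)
    (P : probability T R) (n : nat) (X : 'I_n -> {RV P >-> R}) (K : R) : Prop :=
  {ae P, forall w, \sum_(i < n) X i w = K}.

Definition binary_multinomial d (T : measurableType d) (R : realType)
    (P : probability T R) (n : nat) (X : 'I_n -> {RV P >-> R}) : Prop :=
  {ae P, forall w, (forall i : 'I_n, X i w = 0 \/ X i w = 1) /\
                   exists! i : 'I_n, X i w = 1}.

(* Main.v *)
Require Import Defs.
From HB Require Import structures.
From mathcomp Require Import all_boot all_order all_algebra.
From mathcomp Require Import all_classical all_reals all_analysis.
From mathcomp Require Import measurable_realfun zify.

Set Implicit Arguments.
Unset Strict Implicit.
Unset Printing Implicit Defensive.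

Import Order.TTheory GRing.Theory Num.Theory.
Import numFieldNormedType.Exports.

Local Open Scope classical_set_scope.
Local Open Scope ring_scope.

(** If the components of each summand [Y k] add up to 1, then those of the sum
    of the [N] vectors add up to [N], by exchanging the two summations.

    Conversely, let [X w] have entries [m 0, ..., m (n-1)] with total [N]. The
    partial sums [S 0 = 0 <= S 1 <= ... <= S n = N] cut the integers
    [0, ..., N-1] into [n] consecutive blocks [S i <= k < S (i+1)], the block
    [i] having [m i] elements. Let [Y k i w] be 1 if [k] lies in the block [i]
    and 0 otherwise. Each [k] lies in exactly one block ([block_exists],
    [block_unique]), so [Y k] is binary multinomial; counting the elements of
    the block [i] gives [m i] as the sum over [k] of the [Y k i w]
    ([sum_block]). Each [Y k i] is a random variable, because membership in a
    block compares [k] with partial sums of [X] ([measurable_block]). *)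

(** The entries range over any [nmodType] because the sums are needed twice: in
    [R], where they are random variables, and in [nat], where the integers
    between two of them are counted. The bound [i] is a natural number and not
    an ordinal, so that the last partial sum, of index [n], is also covered. *)
Definition partial_sum (V : nmodType) n (m : 'I_n -> V) (i : nat) : V :=
  \sum_(j < n | (j < i)%N) m j.

Definition block (R : numDomainType) n (m : 'I_n -> R) (k : R) (i : nat) : bool :=
  (partial_sum m i <= k) && (k < partial_sum m i.+1).

Section Blocks.
Variables (n : nat) (m : 'I_n -> nat).

Let S := partial_sum m.

Lemma partial_sum_le i i' : (i <= i')%N -> (S i <= S i')%N.
Proof.
move=> ii'; rewrite /S /partial_sum [leqLHS]big_mkcond [leqRHS]big_mkcond /=.
by apply: leq_sum => j _; case: ifPn => // ji; rewrite (leq_trans ji ii').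
Qed.

Lemma partial_sum_ordS (i : 'I_n) : S i.+1 = (S i + m i)%N.
Proof.
rewrite /S /partial_sum (bigD1 i) //= addnC; congr (_ + _)%N.
by apply: eq_bigl => j; rewrite ltnS -val_eqE /=; lia.
Qed.

Lemma partial_sum_full : S n = \sum_(j < n) m j.
Proof. by apply: eq_bigl => j; rewrite ltn_ord. Qed.

(** The block that contains [k] ends at the first partial sum exceeding [k]. *)
Lemma block_exists k : (k < \sum_(j < n) m j)%N ->
  exists i : 'I_n, (S i <= k < S i.+1)%N.
Proof.
rewrite -partial_sum_full => kn.
have ex : exists i, (k < S i)%N by exists n.
case: (ex_minnP ex) => -[|i] ki imin.
  by move: ki; rewrite /S /partial_sum big_pred0.
exists (Ordinal (imin _ kn)); rewrite /= ki andbT leqNgt.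
by apply/negP => /imin; rewrite ltnn.
Qed.

Lemma block_unique k (i i' : 'I_n) :
  (S i <= k < S i.+1)%N -> (S i' <= k < S i'.+1)%N -> i = i'.
Proof.
move=> /andP[ik ki] /andP[i'k ki']; apply: val_inj => /=.
case: (ltngtP i i') => // /partial_sum_le; lia.
Qed.

(** Proved for all [N] as an identity between truncated differences, so that
    the induction on [N] does not meet the bound [b <= N]. *)
Lemma sum_interval (a b N : nat) : (a <= b <= N)%N ->
  (\sum_(k < N) (a <= k < b) = b - a)%N.
Proof.
move=> /andP[ab bN].
suff -> : (\sum_(k < N) (a <= k < b) = minn N b - minn N a)%N by lia.
elim: N {bN} => [|N IH]; first by rewrite big_ord0 !min0n.
by rewrite big_ord_recr /= IH; lia.
Qed.

Lemma sum_block (i : 'I_n) :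
  (\sum_(k < \sum_(j < n) m j) (S i <= k < S i.+1) = m i)%N.
Proof.
rewrite sum_interval; last first.
  by rewrite -partial_sum_full !partial_sum_le.
by rewrite partial_sum_ordS addKn.
Qed.

Lemma block_natr (R : numDomainType) (k i : nat) :
  block (fun j => (m j)%:R : R) k%:R i = (S i <= k < S i.+1)%N.
Proof. by rewrite /block /partial_sum -!natr_sum ler_nat ltr_nat. Qed.

End Blocks.

Section RandomBlocks.
Context (R : realType) (d : measure_display) (T : measurableType d).
Context (P : probability T R) (n : nat) (X : 'I_n -> {RV P >-> R}).

Lemma measurable_partial_sum i :
  measurable_fun setT (fun w => partial_sum (X ^~ w) i : R).
Proof.
rewrite /partial_sum; under eq_fun => w do rewrite big_mkcond /=.
apply: measurable_sum => j; case: (j < i)%N; first exact: measurable_funPT.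
exact: measurable_cst.
Qed.

Lemma measurable_block k i :
  measurable [set w | block (X ^~ w) k i].
Proof.
rewrite -[X in measurable X]setTI.
suff mblock : measurable_fun setT (fun w => block (X ^~ w) k i).
  exact: (mblock measurableT [set true]).
apply: measurable_and.
  by apply: measurable_fun_ler; [exact: measurable_partial_sum|].
by apply: measurable_fun_ltr; [|exact: measurable_partial_sum].
Qed.

Definition block_indicator (k : R) (i : 'I_n) : {RV P >-> R} :=
  mindic R (measurable_block k i).

Lemma block_indicatorE k i w :
  block_indicator k i w = (block (X ^~ w) k i)%:R.
Proof.
rewrite /= /mindic indicE; congr (nat_of_bool _)%:R.
by apply/idP/idP; rewrite inE.
Qed.

End RandomBlocks.

Lemma sum_binary (R : realType) n (y : 'I_n -> R) :
  (forall i, y i = 0 \/ y i = 1) -> (exists! i, y i = 1) ->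
  \sum_(i < n) y i = 1.
Proof.
move=> y01 [i [yi1 iuniq]]; rewrite (bigD1 i) //= yi1 big1 ?addr0 // => j ji.
by case: (y01 j) => // /iuniq ij; rewrite ij eqxx in ji.
Qed.

Theorem theorem3 (R : realType) (d : measure_display) (T : measurableType d)
    (P : probability T R) (hP : atomless P)
    (n : nat) (hn : (1 <= n)%N) (N : nat)
    (X : 'I_n -> {RV P >-> R}) (hX : Znneg_valued X) :
  joint_mix X N%:R <->
  exists Y : 'I_N -> 'I_n -> {RV P >-> R},
    (forall k : 'I_N, binary_multinomial (Y k)) /\
    {ae P, forall w, forall i : 'I_n, X i w = \sum_(k < N) Y k i w}.
Proof.
split; last first.
  move=> [Y [Ybin XY]].
  have {}Ybin : {ae P, forall w, forall k,
      (forall i, Y k i w = 0 \/ Y k i w = 1) /\ exists! i, Y k i w = 1}.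
    exact: filter_forall.
  apply: filterS2 Ybin XY => w Ybin XY.
  under eq_bigr => i _ do rewrite XY.
  rewrite exchange_big /=.
  under eq_bigr => k _ do rewrite (sum_binary (Ybin k).1 (Ybin k).2).
  by rewrite sumr_const card_ord.
move=> Xmix; exists (fun k i => block_indicator X (k : nat)%:R i).
(* Both claims hold wherever the entries of X are naturals with total N. *)
have Xnat : {ae P, forall w, exists2 m : 'I_n -> nat,
    X ^~ w = (fun j => (m j)%:R) & (\sum_(j < n) m j)%N = N}.
  apply: filterS2 hX Xmix => w Xw sumX.
  have Xm j : X j w = (Num.truncn (X j w))%:R by rewrite truncnK.
  exists (fun j => Num.truncn (X j w)); first exact/funext.
  apply/eqP; rewrite -(eqr_nat R) natr_sum -sumX; apply/eqP.
  by apply: eq_bigr => j _; rewrite -Xm.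
split=> [k|]; apply: filterS Xnat => w [m Xm mN].
- have Yk i : block_indicator X (k : nat)%:R i w =
      (partial_sum m i <= k < partial_sum m i.+1)%N%:R.
    by rewrite block_indicatorE Xm block_natr.
  split=> [i|]; first by rewrite Yk; case: (_ && _); [right|left].
  have /block_exists[i ki] : (k < \sum_(j < n) m j)%N by rewrite mN.
  exists i; split=> [|i']; rewrite Yk ?ki //.
  case: (boolP (_ && _)) => [ki' _|_ /eqP]; last by rewrite eq_sym oner_eq0.
  exact: block_unique ki ki'.
- move=> i; have -> : X i w = (m i)%:R by have := congr1 (@^~ i) Xm.
  rewrite -[in LHS](sum_block m i) mN natr_sum; apply: eq_bigr => k _.
  by rewrite block_indicatorE Xm block_natr.
Qed.
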